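(* Let $G$ be a DAG with vertex set $X$, $|X| = n$, and $m$ edges. Consider the two-phase algorithm UniTopSort: in the preprocessing phase it computes a topological ordering of $G$; in the sorting phase it pushes all items of $X$, in this topological order, into an initially empty heap that has the unified bound, and then performs $n$ pop operations, outputting the popped items in order. Then UniTopSort correctly outputs $X$ sorted by $L$, has $O(n+m)$ preprocessing time and $O(\log e(G) + n)$ sorting time.
   Context: Sorting under partial information: a DAG $G$ on a set $X$ is given, together with an unknown linear order $L$ on $X$ that is compatible with $G$, i.e. $x <_L y$ for every edge $x \to y$ of $G$. An algorithm has a preprocessing phase, in which it may access $G$ but not make comparisons, and a sorting phase, in which it may compare pairs of items with respect to $L$ and must output $X$ sorted along $L$. $e(G)$ denotes the number of linear orders on $X$ compatible with $G$. A heap maintains a set of comparable items under $\texttt{push}(x)$ (add $x$) and $x \gets \texttt{pop}()$ (remove and return the smallest item). For an initially empty heap and a sequence of operations with pushed items $X$, $x$ is the $a(x)$-th item pushed and the $b(x)$-th item popped ($b(x)=\infty$ if never popped). The heap has the unified bound if $\texttt{push}$ takes amortized $O(1)$ time, the first $\texttt{pop}$ amortized $O(1)$ time, and every subsequent $x \gets \texttt{pop}()$ amortized $O\big(\min_{y \in X:\ b(y) < b(x)} (1 + \log |a(x) - a(y)| + \log (b(x) - b(y)))\big)$ time. Logarithms are base 2. *)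

(* Defs.v *)
From mathcomp Require Import all_boot all_order all_algebra.
From mathcomp Require Import reals exp.

Set Implicit Arguments.
Unset Strict Implicit.
Unset Printing Implicit Defensive.

Import Order.TTheory GRing.Theory Num.Theory.

(** * Graphs and linear orders *)

(* A digraph on T is its edge set; a linear order is the set of pairs (x, y)
   such that x is strictly smaller than y. *)
Section Orders.
Variable T : finType.
Implicit Types E L : {set T * T}.

Definition rel_of E : rel T := fun x y => (x, y) \in E.

Definition acyclic E : Prop :=
  forall p : seq T, p != [::] -> ~~ cycle (rel_of E) p.

Definition linear_order L : bool :=
  [&& [forall x, (x, x) \notin L],
      [forall x, forall y, forall z,
         ((x, y) \in L) ==> ((y, z) \in L) ==> ((x, z) \in L)]
    & [forall x, forall y, (x != y) ==> ((x, y) \in L) || ((y, x) \in L)]].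

Definition compatible E L : bool := linear_order L && (E \subset L).

Definition num_orders E : nat := #|[set L | compatible E L]|.

Definition topological_ordering E (s : seq T) : bool :=
  perm_eq s (enum T) &&
  [forall x, forall y, ((x, y) \in E) ==> (index x s < index y s)].

End Orders.

(** * The machine of the preprocessing phase *)

(* A RAM with finitely many named registers and arrays of natural numbers.
   The only arithmetic is successor and predecessor, so that a value can exceed
   the initial contents of the memory only by an amount linear in the running
   time; charging one unit per instruction is then realistic. *)
Inductive expr : Type :=
| Const of nat
| Var of nat
| Get of nat & expr        (* [Get a e]: cell number e of the array a *)
| Succ of expr
| Pred of expr.

Inductive cmd : Type :=
| Skip
| Assign of nat & expr
| Store of nat & expr & expr   (* [Store a e1 e2]: a[e1] := e2 *)
| Seq of cmd & cmd
| IfLt of expr & expr & cmd & cmd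
| WhileLt of expr & expr & cmd.

Record memory := Memory { var : nat -> nat; arr : nat -> nat -> nat }.

Fixpoint eval (st : memory) (e : expr) : nat :=
  match e with
  | Const k => k
  | Var i => var st i
  | Get a e1 => arr st a (eval st e1)
  | Succ e1 => (eval st e1).+1
  | Pred e1 => (eval st e1).-1
  end.

Definition set_var (st : memory) (i v : nat) : memory :=
  Memory (fun j => if j == i then v else var st j) (arr st).

Definition set_arr (st : memory) (a k v : nat) : memory :=
  Memory (var st)
    (fun b l => if (b == a) && (l == k) then v else arr st b l).

(* [exec c st st' t]: started in memory st, the program c halts in memory st'
   after t steps.  Evaluating the expressions of an instruction is part of that
   instruction: their size is bounded by a constant of the program. *)
Inductive exec : cmd -> memory -> memory -> nat -> Prop :=
| exec_skip st : exec Skip st st 1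
| exec_assign st i e : exec (Assign i e) st (set_var st i (eval st e)) 1
| exec_store st a e1 e2 :
    exec (Store a e1 e2) st (set_arr st a (eval st e1) (eval st e2)) 1
| exec_seq c1 c2 st st1 st2 t1 t2 :
    exec c1 st st1 t1 -> exec c2 st1 st2 t2 ->
    exec (Seq c1 c2) st st2 (t1 + t2)
| exec_if_true e1 e2 c1 c2 st st1 t :
    eval st e1 < eval st e2 -> exec c1 st st1 t ->
    exec (IfLt e1 e2 c1 c2) st st1 t.+1
| exec_if_false e1 e2 c1 c2 st st1 t :
    eval st e2 <= eval st e1 -> exec c2 st st1 t ->
    exec (IfLt e1 e2 c1 c2) st st1 t.+1
| exec_while_true e1 e2 c st st1 st2 t1 t2 :
    eval st e1 < eval st e2 -> exec c st st1 t1 ->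
    exec (WhileLt e1 e2 c) st1 st2 t2 ->
    exec (WhileLt e1 e2 c) st st2 (t1 + t2).+1
| exec_while_false e1 e2 c st :
    eval st e2 <= eval st e1 -> exec (WhileLt e1 e2 c) st st 1.

Definition n_var : nat := 0.
Definition off_arr : nat := 0.
Definition adj_arr : nat := 1.
Definition out_arr : nat := 2.

(* Adjacency lists: the out-neighbours of u are listed, in arbitrary order, in
   the cells off[u], ..., off[u+1]-1 of the array adj.  The rest of the memory
   is uninitialised. *)
Definition encodes n (E : {set 'I_n * 'I_n}) (st : memory) : Prop :=
  [/\ var st n_var = n,
      arr st off_arr 0 = 0,
      forall u : 'I_n, arr st off_arr u <= arr st off_arr u.+1
    & forall u : 'I_n,
        perm_eq [seq arr st adj_arr j |
                  j <- index_iota (arr st off_arr u) (arr st off_arr u.+1)]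
                [seq val v | v <- enum [set v | (u, v) \in E]]].

(* The first n cells of the array out; numbers that do not name a vertex are
   dropped, in which case the result is not an ordering of all vertices. *)
Definition output n (st : memory) : seq 'I_n :=
  pmap insub (mkseq (arr st out_arr) n).

Definition computes_topological_ordering (pre : cmd) : Prop :=
  forall n (E : {set 'I_n * 'I_n}) (st : memory),
    acyclic E -> encodes E st ->
    exists st' t, exec pre st st' t /\ topological_ordering E (output n st').

(* O(n + m) time; the additive constant only matters for the empty graph. *)
Definition runs_in_linear_time (pre : cmd) : Prop :=
  exists c : nat,
  forall n (E : {set 'I_n * 'I_n}) (st st' : memory) t,
    acyclic E -> encodes E st -> exec pre st st' t ->
    t <= c * (n + #|E| + 1).

(** * Comparison-based computations *)

(* [Cmp x y k] asks whether x is smaller than y; [Tick] is any other step. *)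
Inductive comp (T A : Type) : Type :=
| Ret of A
| Cmp of T & T & (bool -> comp T A)
| Tick of comp T A.

Arguments Ret {T A} _.
Arguments Cmp {T A} _ _ _.
Arguments Tick {T A} _.

Fixpoint bind (T A B : Type) (c : comp T A) (f : A -> comp T B) : comp T B :=
  match c with
  | Ret a => f a
  | Cmp x y k => Cmp x y (fun b => bind (k b) f)
  | Tick c1 => Tick (bind c1 f)
  end.

Fixpoint run (T A : Type) (lt : rel T) (c : comp T A) : A * nat :=
  match c with
  | Ret a => (a, 0)
  | Cmp x y k => let r := run lt (k (lt x y)) in (r.1, r.2.+1)
  | Tick c1 => let r := run lt c1 in (r.1, r.2.+1)
  end.

(** * Heaps *)

(* The polymorphism in T makes the items opaque to the heap, except for
   comparisons. *)
Record heap := Heap {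
  hstate : Type -> Type;
  hempty : forall T, hstate T;
  hpush : forall T, T -> hstate T -> comp T (hstate T);
  hpop : forall T, hstate T -> comp T (option (T * hstate T))
}.

Inductive op (T : Type) : Type := Push of T | Pop.
Arguments Pop {T}.

Definition pushed (T : Type) (ops : seq (op T)) : seq T :=
  pmap (fun o => if o is Push x then Some x else None) ops.

Fixpoint perform (H : heap) (T : Type) (ops : seq (op T)) (h : hstate H T) :
    comp T (seq T) :=
  match ops with
  | [::] => Ret [::]
  | Push x :: ops' => bind (hpush x h) (fun h' => perform ops' h')
  | Pop :: ops' =>
      bind (hpop h) (fun r =>
        if r is Some (x, h') then
          bind (perform ops' h') (fun out => Ret (x :: out))
        else Ret [::])
  end.

(* [heap_spec L A ops out]: ops is legal on a heap containing the set A of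
   items, and its pops must return the items out, in this order. *)
Inductive heap_spec (T : finType) (L : {set T * T}) :
    {set T} -> seq (op T) -> seq T -> Prop :=
| spec_nil (A : {set T}) : heap_spec L A [::] [::]
| spec_push (A : {set T}) x ops out :
    x \notin A -> heap_spec L (x |: A) ops out ->
    heap_spec L A (Push x :: ops) out
| spec_pop (A : {set T}) x ops out :
    x \in A -> (forall y, y \in A -> y != x -> (x, y) \in L) ->
    heap_spec L (A :\ x) ops out ->
    heap_spec L A (Pop :: ops) (x :: out).

(* Operation sequences on an initially empty heap which push every item at most
   once and never pop from the empty heap. *)
Definition legal (T : finType) (L : {set T * T}) (ops : seq (op T))
    (out : seq T) : Prop :=
  [/\ linear_order L, uniq (pushed ops) & heap_spec L set0 ops out].

Definition heap_correct (H : heap) : Prop :=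
  forall (T : finType) (L : {set T * T}) (ops : seq (op T)) (out : seq T),
    legal L ops out ->
    (run (rel_of L) (perform ops (hempty H T))).1 = out.

Local Open Scope ring_scope.

Definition log2 (R : realType) (x : R) : R := ln x / ln 2.

Section UnifiedBound.
Variables (R : realType) (T : finType) (pushes pops : seq T).

(* a(x) and b(x), counted from 0.  Items that are never popped have
   b(x) = size pops, which exceeds b(y) for every popped item y. *)
Let a (x : T) : nat := index x pushes.
Let b (x : T) : nat := index x pops.

Definition unified_distance (x y : T) : R :=
  1 + log2 `|(a x)%:R - (a y)%:R| + log2 ((b x)%:R - (b y)%:R).

(* The default value of the iterated minimum is the term of the item popped
   first, which is one of the items y such that b(y) < b(x). *)
Definition pop_bound (x : T) : R :=
  if b x == 0%N then 1
  else \big[Num.min/unified_distance x (head x pops)]_(y <- pushes |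
              (b y < b x)%N) unified_distance x y.

Definition unified_cost : R :=
  \sum_(x <- pushes) 1 + \sum_(x <- pops) pop_bound x.

End UnifiedBound.

(* Amortized bounds: over every sequence of operations on an initially empty
   heap, the total time is at most the sum of the bounds of the operations. *)
Definition has_unified_bound (R : realType) (H : heap) : Prop :=
  exists c : R,
  forall (T : finType) (L : {set T * T}) (ops : seq (op T)) (out : seq T),
    legal L ops out ->
    (run (rel_of L) (perform ops (hempty H T))).2%:R
      <= c * unified_cost R (pushed ops) out.

(** * UniTopSort *)

Section SortingPhase.
Variables (H : heap) (T : Type).

Fixpoint push_all (s : seq T) (h : hstate H T) : comp T (hstate H T) :=
  if s is x :: s' then Tick (bind (hpush x h) (fun h' => push_all s' h'))
  else Ret h.

Fixpoint pop_times (k : nat) (h : hstate H T) : comp T (seq T) :=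
  if k is k'.+1 then
    Tick (bind (hpop h) (fun r =>
      if r is Some (x, h') then
        bind (pop_times k' h') (fun out => Ret (x :: out))
      else Ret [::]))
  else Ret [::].

Definition sorting_phase (s : seq T) : comp T (seq T) :=
  bind (push_all s (hempty H T)) (fun h => pop_times (size s) h).

End SortingPhase.

(* On the input st, with hidden order L, UniTopSort outputs out, spending time
   tpre in the preprocessing phase and tsort in the sorting phase. *)
Definition uni_top_sort (pre : cmd) (H : heap) n (L : {set 'I_n * 'I_n})
    (st : memory) (out : seq 'I_n) (tpre tsort : nat) : Prop :=
  exists2 st', exec pre st st' tpre &
    run (rel_of L) (sorting_phase H (output n st')) = (out, tsort).

Definition sorted_along n (L : {set 'I_n * 'I_n}) (out : seq 'I_n) : bool :=
  perm_eq out (enum 'I_n) && sorted (rel_of L) out.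

(* Main.v *)
Require Import Defs.
From mathcomp Require Import all_boot all_order all_algebra.
From mathcomp Require Import reals exp.
From mathcomp Require Import zify lra.

Set Implicit Arguments.
Unset Strict Implicit.
Unset Printing Implicit Defensive.

Import Order.TTheory GRing.Theory Num.Theory.

(** Preprocessing is Kahn's algorithm.

    For the sorting phase, place x at the point (a(x), b(x)) given by its
    positions in the topological order and in L, and let k(x) be the least
    l1-distance from x to a point that is smaller in both coordinates (1 if
    there is none).  If a smaller point exists, popping x costs at most
    1 + 2 log k(x).  If none exists, x is a new minimum of a along L; the
    previous minimum y gives a cost of at most
    1 + (a(y) - a(x)) + (b(x) - b(y)), and these terms telescope to O(n).

    It remains to see that the sum of log k(x) is at most log e(G) + O(n).  Give
    x the integer interval I(x) of length k(x) ending at s(x) = a(x) + b(x).  An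
    edge x -> y makes x smaller than y in both coordinates, so
    s(x) + k(y) <= s(y) and I(x) lies to the left of I(y).  Hence choosing a
    point in every interval and sorting by it gives an order compatible with G;
    the choice is recovered from this order and the multiset of chosen values,
    and there are at most 2^(3n) such multisets.  So the product of the k(x) is
    at most 2^(3n) e(G). *)

(** * The sorting phase *)

Section LinearOrders.
Variables (T : finType) (L : {set T * T}).
Hypothesis linL : linear_order L.

Lemma linear_irr x : (x, x) \notin L.
Proof. by case/and3P: linL => /forallP. Qed.

Lemma linear_trans : transitive (rel_of L).
Proof.
case/and3P: linL => _ /forallP h _ y x z xy yz.
by move/forallP: (h x) => /(_ y)/forallP/(_ z)/implyP/(_ xy)/implyP/(_ yz).
Qed.

Lemma linear_total x y : x != y -> ((x, y) \in L) || ((y, x) \in L).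
Proof.
case/and3P: linL => _ _ /forallP h.
by move: (h x) => /forallP/(_ y)/implyP.
Qed.

(** Sorting by the reflexive closure of [L] gives a weakly sorted list, and the distinctness of its
    entries makes every step strict. *)
Lemma linear_sorted_exists :
  exists2 out : seq T, perm_eq out (enum T) & sorted (rel_of L) out.
Proof.
pose le : rel T := fun x y => (x == y) || ((x, y) \in L).
have le_total : total le.
  move=> x y; rewrite /le; have [->|/linear_total/orP[]->] := eqVneq x y;
    by rewrite ?eqxx ?orbT.
exists (sort le (enum T)); first by rewrite perm_sort.
have : uniq (sort le (enum T)) by rewrite sort_uniq enum_uniq.
have := sort_sorted le_total (enum T).
case: (sort le (enum T)) => //= x s.
elim: s x => //= y s IH x /andP[lexy py] /andP[]; rewrite inE negb_or.
case/andP => xy _ us; rewrite (IH y py us) andbT.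
by move: lexy; rewrite /le (negPf xy).
Qed.

Lemma index_sorted_linear (out : seq T) :
  perm_eq out (enum T) -> sorted (rel_of L) out ->
  forall x y, (index x out < index y out) = ((x, y) \in L).
Proof.
move=> out_enum out_sorted.
have in_out x : x \in out by rewrite (perm_mem out_enum) mem_enum.
have lt_in x y : index x out < index y out -> (x, y) \in L.
  exact: (sorted_ltn_index linear_trans).
move=> x y; apply/idP/idP => [|xy]; first exact: lt_in.
rewrite ltnNge leq_eqVlt; apply/negP => /orP[/eqP e|/lt_in yx].
  have := linear_irr x.
  by rewrite -{2}(nth_index x (in_out x)) -e nth_index ?xy.
by have := linear_irr x; have /= := linear_trans xy yx; rewrite /rel_of => ->.
Qed.

End LinearOrders.

(** * Counting compatible orders by integer points of a box *)

Lemma card_ord_interval (N s k : nat) : s < N -> k <= s.+1 ->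
  k <= #|[pred i : 'I_N | (s < i + k) && (i <= s)]|.
Proof.
move=> sN ks; rewrite -[X in X <= _](card_ord k).
have lt (i : 'I_k) : s - i < N by lia.
pose f (i : 'I_k) := Ordinal (lt i).
have f_inj : injective f.
  move=> i j /(congr1 val) /= e; apply: val_inj => /=.
  by have := ltn_ord i; have := ltn_ord j; lia.
rewrite -(card_codom f_inj); apply: subset_leq_card; apply/subsetP => _ /codomP[i ->].
by rewrite inE /=; have := ltn_ord i; lia.
Qed.

Section BoxVolume.
Variables (T : finType) (E : {set T * T}) (b : T -> nat) (N : nat).
Hypothesis b_inj : injective b.
Implicit Types p : {ffun T -> 'I_N}.

(** Sorts by the chosen points; the injective [b] breaks ties, which occur because the intervals of
    incomparable items may overlap. *)
Definition lex_order p : {set T * T} :=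
  [set z | (p z.1 < p z.2) || ((p z.1 == p z.2) && (b z.1 < b z.2))].

Lemma lex_order_linear p : linear_order (lex_order p).
Proof.
apply/and3P; split.
- by apply/forallP => x; rewrite inE /= !ltnn andbF.
- apply/forallP => x; apply/forallP => y; apply/forallP => z.
  rewrite !inE /= -!val_eqE /=; apply/implyP => xy; apply/implyP => yz; lia.
- apply/forallP => x; apply/forallP => y; apply/implyP => xy.
  rewrite !inE /= -!val_eqE /=.
  have : b x != b y by apply: contra_neq xy => /b_inj.
  lia.
Qed.

Definition lex_rank p x := #|[set y | (y, x) \in lex_order p]|.

Lemma lex_rank_lt p x : lex_rank p x < #|T|.
Proof.
rewrite -cardsT; apply/proper_card/properP; split; first exact: subsetT.
by exists x; rewrite ?inE //= !ltnn andbF.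
Qed.

Lemma lex_rank_mono p x y : (x, y) \in lex_order p -> lex_rank p x < lex_rank p y.
Proof.
move=> xy; apply/proper_card/properP; split.
  apply/subsetP => z; rewrite !inE /= -!val_eqE /=.
  by move: xy; rewrite !inE /= -!val_eqE /=; lia.
by exists x; rewrite ?inE //= ?ltnn ?andbF //; move: xy; rewrite inE.
Qed.

(** Adding the rank separates equal values: this is the usual passage from multisets to sets, so the
    multiset of values of [p] becomes a subset of ['I_(N + #|T|)]. *)
Definition code p (x : T) : nat := p x + lex_rank p x.

Lemma code_lt p x : code p x < N + #|T|.
Proof. by rewrite -addSn leq_add // ltnW // lex_rank_lt. Qed.

Definition ocode p (x : T) : 'I_(N + #|T|) := Ordinal (code_lt p x).

(** Along the order the values of [p] increase weakly and the ranks strictly; the converse follows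
    by totality. *)
Lemma code_mono p x y : ((x, y) \in lex_order p) = (code p x < code p y).
Proof.
have mono u v : (u, v) \in lex_order p -> code p u < code p v.
  move=> uv; rewrite -addnS leq_add ?lex_rank_mono //.
  by move: uv; rewrite !inE /= -!val_eqE /=; lia.
apply/idP/idP => [|xy]; first exact: mono.
have xy' : x != y by apply: contraTneq xy => ->; rewrite ltnn.
case/orP: (linear_total (lex_order_linear p) xy') => // /mono; lia.
Qed.

Lemma ocode_inj p : injective (ocode p).
Proof.
move=> x y /(congr1 val) /= e; apply/eqP; apply/negPn/negP => xy.
by case/orP: (linear_total (lex_order_linear p) xy); rewrite code_mono e ltnn.
Qed.

Definition code_set p : {set 'I_(N + #|T|)} := ocode p @: T.

Lemma card_code_below p x :
  #|[set w in code_set p | w < code p x]| = lex_rank p x.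
Proof.
rewrite /lex_rank -(card_imset _ (@ocode_inj p)); apply: eq_card => w.
rewrite inE; apply/andP/imsetP => [[/imsetP[y _ ->]]|[y]] /=.
  by rewrite -code_mono => yx; exists y; rewrite ?inE // in yx *.
rewrite inE code_mono => yx ->; split=> //; exact: imset_f.
Qed.

(* The order determines the rank r(x) of x, and p(x) + r(x) is the element of
   rank r(x) of the code set. *)
Lemma code_inj : injective (fun p => (lex_order p, code_set p)).
Proof.
suff le p q x : lex_order p = lex_order q -> code_set p = code_set q ->
    code p x <= code q x.
  move=> p q [eL eS]; apply/ffunP => x; apply: val_inj.
  have : code p x = code q x by apply/eqP; rewrite eqn_leq !le.
  by rewrite /code /lex_rank eL => /addIn.
(* If the code of x were smaller under [q], then [ocode q x] would make the elements of the common
   code set below [code p x] strictly more numerous than those below [code q x]; but both numbers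
   are the rank of x. *)
move=> eL eS; rewrite leqNgt; apply/negP => lt_qp.
have := card_code_below p x; rewrite /lex_rank eL -/(lex_rank q x).
rewrite -(card_code_below q x) eS => /eqP; apply/negP; rewrite neq_ltn.
apply/orP; right; apply/proper_card/properP; split.
  by apply/subsetP => w; rewrite !inE => /andP[->] /= /ltn_trans; apply.
by exists (ocode q x); rewrite !inE /= ?ltnn ?andbF ?lt_qp ?imset_f.
Qed.

Lemma box_volume (s k : T -> nat) :
  (forall x, s x < N) -> (forall x, k x <= (s x).+1) ->
  (forall x y, (x, y) \in E -> s x + k y <= s y) ->
  \prod_x k x <= num_orders E * 2 ^ (N + #|T|).
Proof.
move=> sN ks sE.
pose I x := [pred i : 'I_N | (s x < i + k x) && (i <= s x)].
apply: (@leq_trans #|family I|).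
  rewrite card_family foldrE big_map big_enum /=.
  by apply: leq_prod => x _; apply: card_ord_interval.
have -> : num_orders E * 2 ^ (N + #|T|) =
    #|setX [set L | compatible E L] [set: {set 'I_(N + #|T|)}]|.
  by rewrite cardsX -powersetT card_powerset cardsT card_ord.
rewrite -(card_imset _ code_inj); apply: subset_leq_card.
apply/subsetP => _ /imsetP[p /familyP pI ->]; rewrite !inE andbT.
rewrite /compatible lex_order_linear; apply/subsetP => -[x y] xy.
move: (pI x) (pI y) => /andP[_ px] /andP[py _]; rewrite inE /=.
(* On an edge, [p x <= s x] and [s x + k y <= s y < p y + k y] give [p x < p y]. *)
apply/orP; left; apply: leq_ltn_trans px _.
by rewrite -(ltn_add2r (k y)); apply: leq_ltn_trans (sE _ _ xy) py.
Qed.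

End BoxVolume.

(** * Successive minima and telescoping sums *)

Section Records.
Variable A : nat -> nat.

(** The first position at which [A] attains its minimum over 0, ..., j. *)
Fixpoint last_record j :=
  if j is i.+1 then
    if A j < A (last_record i) then j else last_record i
  else 0.

Lemma last_record_le j : last_record j <= j.
Proof. by elim: j => //= j IH; case: ifP => // _; apply: leqW. Qed.

Lemma last_record_noninc j : A (last_record j.+1) <= A (last_record j).
Proof. by rewrite /=; case: ifP => // /ltnW. Qed.

End Records.

(** The sum telescopes; its term at j = 0 vanishes because [0.-1] is 0. *)
Lemma sum_increments_le (F : nat -> nat) n :
  (forall j, F j <= F j.+1) -> \sum_(j < n) (F j - F j.-1) <= F n.-1.
Proof.
move=> F_mono; elim: n => [|[|n] IH]; rewrite ?big_ord0 ?big_ord1 ?leq_subr //.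
rewrite big_ord_recr /=; apply: leq_trans (leq_add IH (leqnn _)) _.
by rewrite subnKC.
Qed.

(** * Logarithms to base 2 *)

Section Log2.
Variable R : realType.
Local Open Scope ring_scope.

Lemma ln2_gt0 : 0 < ln 2 :> R.
Proof. by rewrite ln_gt0 // ltr1n. Qed.

Lemma log2M (x y : R) : 0 < x -> 0 < y -> log2 (x * y) = log2 x + log2 y.
Proof. by move=> x0 y0; rewrite /log2 lnM ?posrE // mulrDl. Qed.

Lemma log2X n : log2 (2 ^+ n : R) = n%:R.
Proof. by rewrite /log2 lnXn // mulrnAl divff ?gt_eqF ?ln2_gt0. Qed.

Lemma ler_log2 (x y : R) : 0 < x -> x <= y -> log2 x <= log2 y.
Proof.
move=> x0 xy; rewrite ler_pM2r ?invr_gt0 ?ln2_gt0 //.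
by rewrite ler_ln ?posrE // (lt_le_trans x0).
Qed.

Lemma log2_ge0 (x : R) : 1 <= x -> 0 <= log2 x.
Proof. by move=> x1; apply: divr_ge0; [exact: ln_ge0 | exact/ltW/ln2_gt0]. Qed.

Lemma log2_natr_le n : (0 < n)%N -> log2 (n%:R : R) <= n%:R.
Proof.
move=> n0; rewrite -[leRHS]log2X ler_log2 ?ltr0n // -natrX ler_nat.
exact/ltnW/ltn_expl.
Qed.

Lemma sum_log2 (I : finType) (k : I -> nat) : (forall i, 0 < k i)%N ->
  \sum_i log2 (k i)%:R = log2 (\prod_i k i)%:R :> R.
Proof.
move=> k0.
(* Positivity of the partial products is carried along, since [log2M] asks for it. *)
suff [] : (0 < \prod_i k i)%N /\ \sum_i log2 (k i)%:R = log2 (\prod_i k i)%:R :> R by [].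
apply: (big_rec2 (fun v (u : R) => (0 < v)%N /\ u = log2 v%:R)).
  by split=> //; rewrite /log2 ln1 mul0r.
move=> i v u _ [v0 ->]; split; first by rewrite muln_gt0 k0.
by rewrite natrM log2M ?ltr0n.
Qed.

End Log2.

(** * The unified cost of the operations of UniTopSort *)

Section UnifiedCost.
Variables (R : realType) (T : finType) (E L : {set T * T}) (s out : seq T).
Hypothesis s_top : topological_ordering E s.
Hypothesis compat : compatible E L.
Hypothesis out_enum : perm_eq out (enum T).
Hypothesis out_sorted : sorted (rel_of L) out.

Let a x := index x s.
Let b x := index x out.
Let n := #|T|.

Let in_s x : x \in s.
Proof. by case/andP: s_top => /perm_mem -> _; rewrite mem_enum. Qed.

Let in_out x : x \in out.
Proof. by rewrite (perm_mem out_enum) mem_enum. Qed.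

Let size_s : size s = n.
Proof. by case/andP: s_top => /perm_size -> _; rewrite -cardE. Qed.

Let size_out : size out = n.
Proof. by rewrite (perm_size out_enum) -cardE. Qed.

Let uniq_out : uniq out.
Proof. by rewrite (perm_uniq out_enum) enum_uniq. Qed.

Let a_lt x : a x < n.
Proof. by rewrite -size_s index_mem in_s. Qed.

Let b_lt x : b x < n.
Proof. by rewrite -size_out index_mem in_out. Qed.

Let a_inj : injective a.
Proof. by move=> x y e; rewrite -(nth_index x (in_s x)) -/(a x) e nth_index. Qed.

Let b_inj : injective b.
Proof. by move=> x y e; rewrite -(nth_index x (in_out x)) -/(b x) e nth_index. Qed.

Definition below y x := (a y < a x) && (b y < b x).

Let gap x y := (a x - a y) + (b x - b y).

(** The k(x) of the overview; the default 1 makes its logarithm 0 and keeps the product positive. *)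
Definition min_gap x : nat :=
  if [pick y | below y x] is Some y0 then
    gap x [arg min_(y < y0 | below y x) gap x y]
  else 1.

Lemma min_gap_attained y x :
  below y x -> exists2 z, below z x & min_gap x = gap x z.
Proof.
rewrite /min_gap; case: pickP => [y0 y0x _|/(_ y) -> //].
by case: arg_minnP => // z zx _; exists z.
Qed.

Lemma min_gap_le y x : below y x -> min_gap x <= gap x y.
Proof.
rewrite /min_gap; case: pickP => [y0 y0x yx|/(_ y) -> //].
by case: arg_minnP => // z _; apply.
Qed.

Lemma min_gap_bounds x : 0 < min_gap x <= (a x + b x).+1.
Proof.
rewrite /min_gap; case: pickP => // y0 y0x.
by case: arg_minnP => // z; rewrite /below /gap; lia.
Qed.

Lemma edge_below x y : (x, y) \in E -> below x y.
Proof.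
move=> xy; case/andP: s_top => _ /forallP/(_ x)/forallP/(_ y)/implyP/(_ xy) axy.
case/andP: compat => linL /subsetP/(_ _ xy) xyL; rewrite /below axy.
by rewrite /b (index_sorted_linear linL).
Qed.

Lemma prod_min_gap : \prod_x min_gap x <= num_orders E * 2 ^ (3 * n).
Proof.
(* Both coordinates are below n, so their sums are below N = 2n; the ranks in the codes account for
   the third n. *)
rewrite (_ : 3 * n = n.*2 + #|T|); last by rewrite /n; lia.
apply: (box_volume b_inj (s := fun x => a x + b x)) => [x|x|x y /edge_below xy].
- by have := a_lt x; have := b_lt x; lia.
- by case/andP: (min_gap_bounds x).
- by have := min_gap_le xy; move: xy; rewrite /below /gap; lia.
Qed.

Local Open Scope ring_scope.

Lemma pop_bound_le x y : (b y < b x)%N ->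
  pop_bound R s out x <= unified_distance R s out x y.
Proof.
move=> yx; rewrite /pop_bound -/(b x) gtn_eqF ?(leq_ltn_trans _ yx) //.
exact: ge_bigmin_seq.
Qed.

(** Each coordinate difference is positive and at most the gap, so each of the two logarithms is at
    most that of [k]. *)
Lemma log2_gap_le k x y : below y x -> (gap x y <= k)%N ->
  unified_distance R s out x y <= 1 + 2 * log2 k%:R.
Proof.
case/andP=> ayx byx le_k.
rewrite /unified_distance -/(a x) -/(a y) -/(b x) -/(b y).
rewrite -!natrB ?(ltnW ayx) ?(ltnW byx) // normr_nat.
have le_log d : (0 < d <= k)%N -> log2 (d%:R : R) <= log2 k%:R.
  by case/andP=> d0 dk; rewrite ler_log2 ?ltr0n ?ler_nat.
have := le_log (a x - a y)%N; have := le_log (b x - b y)%N.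
move=> /(_ ltac:(move: le_k; rewrite /gap; lia)) hb.
by move=> /(_ ltac:(move: le_k; rewrite /gap; lia)) ha; lra.
Qed.

(* Popped items above no item are the successive minima of [a] along [out];
   [F] increases by both coordinate differences at each of them. *)
Lemma sum_pop_bound :
  \sum_(x <- out) pop_bound R s out x <= 9 * n%:R + 2 * log2 (num_orders E)%:R.
Proof.
have sum_k : \sum_x log2 ((min_gap x)%:R : R) <= log2 (num_orders E)%:R + 3 * n%:R.
  have k0 x : (0 < min_gap x)%N by case/andP: (min_gap_bounds x).
  have e0 : (0 < num_orders E)%N.
    by rewrite card_gt0; apply/set0Pn; exists L; rewrite inE.
  rewrite sum_log2 // -natrM -(@log2X R (3 * n)) -log2M ?ltr0n ?exprn_gt0 //.
  rewrite ler_log2 ?ltr0n ?prodn_gt0 // -natrX -natrM ler_nat.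
  exact: prod_min_gap.
(* The empty case is separate because [nth] needs a default item [x0]. *)
case: (posnP n) => [n0|n_gt0].
  have -> : out = [::] by apply: size0nil; rewrite size_out.
  have : 0 <= \sum_x log2 ((min_gap x)%:R : R).
    apply: sumr_ge0 => x _; apply: log2_ge0; rewrite ler1n.
    by case/andP: (min_gap_bounds x).
  by rewrite big_nil; move: sum_k; rewrite n0; lra.
have /card_gt0P[x0 _] := n_gt0.
pose A j := a (nth x0 out j).
pose F j := (last_record A j + (n - A (last_record A j)))%N.
have A_lt j : (A j < n)%N by exact: a_lt.
have F_mono j : (F j <= F j.+1)%N.
  have := last_record_noninc A j; have := A_lt (last_record A j.+1).
  have := A_lt (last_record A j); rewrite /F /=.
  by case: ifP => // _; have := last_record_le A j; lia.
have bound x : pop_bound R s out x <=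
    1 + 2 * log2 (min_gap x)%:R + (F (b x) - F (b x).-1)%:R.
  have k0 : 0 <= log2 ((min_gap x)%:R : R).
    by apply: log2_ge0; rewrite ler1n; case/andP: (min_gap_bounds x).
  case: (posnP (b x)) => [b0|b_gt0].
    by rewrite /pop_bound -/(b x) b0 eqxx subnn; lra.
  have [y yx|minx] := pickP (fun y => below y x).
    have [z zx ->] := min_gap_attained yx.
    apply: le_trans (pop_bound_le _) _; first by case/andP: zx => _; apply.
    by apply: ler_wpDr; rewrite ?ler0n // log2_gap_le.
  (* [z] has the least a among the items popped before x. As it is not below x, a(x) < a(z): x is a
     new record, and [F] grows by both differences to [z]. *)
  pose z := nth x0 out (last_record A (b x).-1).
  have r_lt : (last_record A (b x).-1 < b x)%N.
    by rewrite -[X in (_ < X)%N](prednK b_gt0) ltnS last_record_le.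
  have bz : b z = last_record A (b x).-1.
    by rewrite /b index_uniq // size_out (ltn_trans r_lt).
  have bzx : (b z < b x)%N by rewrite bz.
  have Abx : A (b x) = a x by rewrite /A nth_index.
  have azx : (a x < a z)%N.
    have := minx z; rewrite /below bzx andbT => /negbT; rewrite -leqNgt leq_eqVlt.
    by case/orP=> // /eqP/a_inj e; move: bzx; rewrite -e ltnn.
  have rec_x : last_record A (b x) = b x.
    by move: azx; rewrite -Abx -[b x](prednK b_gt0) /= => ->.
  apply: le_trans (pop_bound_le bzx) _.
  rewrite /unified_distance -/(a x) -/(a z) -/(b x) -/(b z) distrC.
  rewrite -!natrB ?(ltnW azx) ?(ltnW bzx) // normr_nat.
  have ha : log2 ((a z - a x)%:R : R) <= (a z - a x)%:R by rewrite log2_natr_le // subn_gt0.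
  have hb : log2 ((b x - b z)%:R : R) <= (b x - b z)%:R by rewrite log2_natr_le // subn_gt0.
  have hF : (a z - a x + (b x - b z) <= F (b x) - F (b x).-1)%N.
    have Az : A (last_record A (b x).-1) = a z by [].
    rewrite /F rec_x Abx Az -bz.
    by have := a_lt x; have := a_lt z; lia.
  by move: hF; rewrite -(ler_nat R) natrD; lra.
(* The 9n is n from the ones, 2 * 3n from [sum_k], and 2n from the telescoped [F], whose values are
   at most 2n. *)
apply: le_trans (ler_sum _ (fun x _ => bound x)) _.
rewrite !big_split /= -mulr_sumr.
have -> : \sum_(x <- out) log2 ((min_gap x)%:R : R) = \sum_x log2 (min_gap x)%:R.
  by rewrite (perm_big _ out_enum) big_enum.
have -> : \sum_(x <- out) (1 : R) = n%:R.
  by rewrite big_const_seq count_predT iter_addr_0 size_out.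
have : \sum_(x <- out) ((F (b x) - F (b x).-1)%:R : R) <= (2 * n)%:R.
  rewrite -natr_sum ler_nat (big_nth x0) size_out big_mkord.
  have -> : (\sum_(j < n) (F (b (nth x0 out j)) - F (b (nth x0 out j)).-1) =
             \sum_(j < n) (F j - F j.-1))%N.
    by apply: eq_bigr => j _; rewrite /b index_uniq // size_out.
  apply: leq_trans (sum_increments_le _ F_mono) _.
  by have := last_record_le A n.-1; rewrite /F; lia.
by rewrite natrM; lra.
Qed.

Lemma unified_cost_le :
  unified_cost R s out <= 10 * (log2 (num_orders E)%:R + n%:R).
Proof.
have e0 : (1 : R) <= (num_orders E)%:R.
  by rewrite ler1n card_gt0; apply/set0Pn; exists L; rewrite inE.
have := log2_ge0 e0; have := sum_pop_bound.
rewrite /unified_cost big_const_seq count_predT iter_addr_0 size_s; lra.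
Qed.

End UnifiedCost.

(** * The sorting phase as a legal operation sequence *)

Lemma run_bind (T A B : Type) (lt : rel T) (c : Defs.comp T A) (f : A -> Defs.comp T B) :
  run lt (bind c f) =
  ((run lt (f (run lt c).1)).1, (run lt c).2 + (run lt (f (run lt c).1)).2).
Proof.
elim: c => [a|x y k IH|c IH] /=; first by case: (run lt (f a)).
- by rewrite IH.
- by rewrite IH.
Qed.

Section SortingRun.
Variables (H : heap) (T : Type) (lt : rel T).

(** The loop differs from [perform] only by one [Tick] per round; a pop that returns [None] ends it
    early, hence the inequality. *)
Lemma run_pop_times k (h : hstate H T) :
  (run lt (pop_times k h)).1 = (run lt (perform (H := H) (nseq k Pop) h)).1 /\
  (run lt (pop_times k h)).2 <= (run lt (perform (H := H) (nseq k Pop) h)).2 + k.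
Proof.
elim: k h => [|k IH] h //=; rewrite !run_bind /=.
case: (run lt (hpop h)).1 => [[x h']|] /=; last by split=> //; lia.
by rewrite !run_bind /=; have [-> le] := IH h'; split=> //; lia.
Qed.

Lemma run_push_all s k (h : hstate H T) :
  let r := run lt (bind (push_all s h) (pop_times k)) in
  let r' := run lt (perform (H := H) (map (@Push T) s ++ nseq k Pop) h) in
  r.1 = r'.1 /\ r.2 <= r'.2 + size s + k.
Proof.
elim: s h => [|x s IH] h /=.
  by have [-> le] := run_pop_times k h; split=> //; lia.
have [e le] := IH (run lt (hpush x h)).1; move: e le.
rewrite !run_bind /= => -> le; split=> //; lia.
Qed.

End SortingRun.

Section SortingSpec.
Variables (T : finType) (L : {set T * T}).
Hypothesis linL : linear_order L.

(** By transitivity the head of a sorted list precedes all later entries, so it is the item that the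
    next pop must return. *)
Lemma heap_spec_pops out : uniq out -> sorted (rel_of L) out ->
  heap_spec L [set x in out] (nseq (size out) Pop) out.
Proof.
elim: out => [|x out IH] /=; first by move=> _ _; apply: spec_nil.
case/andP=> x_out u_out x_path; apply: spec_pop.
- by rewrite !inE eqxx.
- move=> y; rewrite !inE => /orP[->//|y_out] _.
  by have /allP/(_ y y_out) := order_path_min (linear_trans linL) x_path.
- rewrite (_ : _ :\ x = [set y in out]); first by apply: IH => //; exact: path_sorted x_path.
  apply/setP => y; rewrite !inE; case: eqVneq => [->|//] /=.
  by rewrite (negPf x_out).
Qed.

Lemma heap_spec_pushes (A : {set T}) s ops out :
  uniq s -> {in s, forall x, x \notin A} ->
  heap_spec L (A :|: [set x in s]) ops out ->
  heap_spec L A (map (@Push T) s ++ ops) out.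
Proof.
elim: s A => [|x s IH] A /=.
  by move=> _ _; rewrite (_ : _ :|: _ = A) //; apply/setP => y; rewrite !inE orbF.
case/andP=> x_s u_s sA spec; apply: spec_push; first by rewrite sA ?mem_head.
apply: IH => // [y y_s|]; last first.
  rewrite (_ : _ :|: _ = A :|: [set y in x :: s]) //.
  by apply/setP => y; rewrite !inE orbA (orbC (y == x)).
rewrite !inE negb_or sA ?inE ?y_s ?orbT // andbT.
by apply: contraNneq x_s => <-.
Qed.

Lemma pushed_sorting s k : pushed (map (@Push T) s ++ nseq k Pop) = s.
Proof.
by elim: s => [|x s IH]; [elim: k | rewrite /pushed /= -/(pushed _) IH].
Qed.

Lemma legal_sorting s out :
  perm_eq s (enum T) -> perm_eq out (enum T) -> sorted (rel_of L) out ->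
  legal L (map (@Push T) s ++ nseq (size s) Pop) out.
Proof.
move=> s_enum out_enum out_sorted.
have u_s : uniq s by rewrite (perm_uniq s_enum) enum_uniq.
have u_out : uniq out by rewrite (perm_uniq out_enum) enum_uniq.
split=> //; first by rewrite pushed_sorting.
apply: heap_spec_pushes => // [x _|]; first by rewrite inE.
rewrite (perm_size s_enum) -(perm_size out_enum).
rewrite (_ : _ :|: _ = [set x in out]); first exact: heap_spec_pops.
by apply/setP => x; rewrite !inE (perm_mem s_enum) (perm_mem out_enum).
Qed.

End SortingSpec.

Section UnifiedCostNonneg.
Variables (R : realType) (T : finType) (pushes pops : seq T).
Local Open Scope ring_scope.

Lemma log2_natr_ge0 k : 0 <= log2 (k%:R : R).
Proof.
(* The value at 0 is 0, by the convention for [ln]. *)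
case: k => [|k]; first by rewrite /log2 ln0 // mul0r.
by apply: log2_ge0; rewrite ler1n.
Qed.

(** The non-strict hypothesis also covers the default term of the minimum, where y is [head x pops];
    this is x itself if nothing is popped. *)
Lemma unified_distance_ge0 x y : (index y pops <= index x pops)%N ->
  0 <= unified_distance R pushes pops x y.
Proof.
move=> yx; rewrite /unified_distance -(natrB _ yx).
have [h|/ltnW h] := leqP (index y pushes) (index x pushes).
  by rewrite -natrB // normr_nat !addr_ge0 ?log2_natr_ge0.
by rewrite distrC -natrB // normr_nat !addr_ge0 ?log2_natr_ge0.
Qed.

Lemma unified_cost_ge0 : 0 <= unified_cost R pushes pops.
Proof.
apply: addr_ge0; first exact: sumr_ge0.
apply: sumr_ge0 => x _; rewrite /pop_bound; case: ifP => // _.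
apply: le_bigmin => [|y /ltnW]; apply: unified_distance_ge0.
by case: pops => //= z p; rewrite eqxx.
Qed.

End UnifiedCostNonneg.

Lemma sorting_phase_correct (R : realType) (H : heap) :
  heap_correct H -> has_unified_bound R H ->
  exists c : R, forall (T : finType) (E L : {set T * T}) (s : seq T),
    topological_ordering E s -> compatible E L ->
    let r := run (rel_of L) (sorting_phase H s) in
    [/\ perm_eq r.1 (enum T), sorted (rel_of L) r.1 &
        (r.2%:R <= c * (log2 (num_orders E)%:R + #|T|%:R))%R].
Proof.
move=> H_correct [c H_bound].
(* The 2 pays for the ticks of n pushes and n pops, the 10 comes from [unified_cost_le], and the
   maximum covers a negative [c]. *)
exists (2 + 10 * Num.max c 0)%R => T E L s s_top compat r.
have linL : linear_order L by case/andP: compat.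
have [out out_enum out_sorted] := linear_sorted_exists linL.
have s_enum : perm_eq s (enum T) by case/andP: s_top.
have leg := legal_sorting linL s_enum out_enum out_sorted.
have [] := run_push_all (rel_of L) s (size s) (hempty H T).
rewrite -/(sorting_phase H s) -/r (H_correct _ _ _ _ leg) => -> r_time.
split=> //.
move: r_time (H_bound _ _ _ _ leg); rewrite pushed_sorting.
rewrite (perm_size s_enum) -cardE.
have := unified_cost_le R s_top compat out_enum out_sorted.
set t := (run _ _).2; set l := log2 _; set u := unified_cost _ _ _.
rewrite -(ler_nat R) !natrD => le_u r_time t_le.
have l0 : (0 <= l)%R.
  apply: log2_ge0.
  by rewrite ler1n card_gt0; apply/set0Pn; exists L; rewrite inE.
have u0 : (0 <= u)%R by exact: unified_cost_ge0.
have c_le : (c * u <= Num.max c 0 * u)%R by rewrite ler_wpM2r // le_max lexx.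
have c0 : (0 <= Num.max c 0)%R by rewrite le_max lexx orbT.
have u_le : (Num.max c 0 * u <= Num.max c 0 * (10 * (l + #|T|%:R)))%R.
  by rewrite ler_wpM2l.
by rewrite mulrDl; move: u_le; rewrite mulrCA mulrA; lra.
Qed.

(** * The preprocessing phase *)

Lemma exec_det c st st1 st2 t1 t2 :
  exec c st st1 t1 -> exec c st st2 t2 -> st1 = st2 /\ t1 = t2.
Proof.
move=> run1; elim: run1 st2 t2 => {c st st1 t1}.
- by move=> st st2 t2 run2; inversion run2.
- by move=> st i e st2 t2 run2; inversion run2.
- by move=> st a e1 e2 st2 t2 run2; inversion run2.
- move=> c1 c2 st s1 s2 u1 u2 _ IH1 _ IH2 st2 t2 run2; inversion run2; subst.
  match goal with H : exec c1 _ _ _ |- _ => have [? ?] := IH1 _ _ H; subst end.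
  by match goal with H : exec c2 _ _ _ |- _ => have [? ?] := IH2 _ _ H; subst end.
- move=> e1 e2 c1 c2 st s1 t lt _ IH st2 t2 run2; inversion run2; subst; last by lia.
  by match goal with H : exec c1 _ _ _ |- _ => have [? ?] := IH _ _ H; subst end.
- move=> e1 e2 c1 c2 st s1 t le _ IH st2 t2 run2; inversion run2; subst; first by lia.
  by match goal with H : exec c2 _ _ _ |- _ => have [? ?] := IH _ _ H; subst end.
- move=> e1 e2 c st s1 s2 u1 u2 lt _ IH1 _ IH2 st2 t2 run2.
  inversion run2; subst; last by lia.
  match goal with H : exec c _ _ _ |- _ => have [? ?] := IH1 _ _ H; subst end.
  match goal with H : exec (WhileLt _ _ _) _ _ _ |- _ =>
    by have [? ?] := IH2 _ _ H; subst end.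
- by move=> e1 e2 c st le st2 t2 run2; inversion run2; subst => //; lia.
Qed.

(** A total-correctness triple with a time bound. It exhibits one run; [exec_det] carries its time
    bound over to every run. *)
Definition total (c : cmd) (st : memory) (T : nat) (Q : memory -> Prop) : Prop :=
  exists st' t, [/\ exec c st st' t, t <= T & Q st'].

Section TotalCorrectness.
Implicit Types (c : cmd) (st : memory) (Q : memory -> Prop).

Lemma total_le c st T T' Q : T <= T' -> total c st T Q -> total c st T' Q.
Proof.
move=> le [st' [t [run t_le q]]]; exists st', t; split=> //.
exact: leq_trans le.
Qed.

Lemma total_imp c st T Q Q' :
  (forall st', Q st' -> Q' st') -> total c st T Q -> total c st T Q'.
Proof. by move=> imp [st' [t [run t_le q]]]; exists st', t; split; auto. Qed.

Lemma total_skip st Q : Q st -> total Skip st 1 Q.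
Proof. by exists st, 1; split=> //; constructor. Qed.

Lemma total_assign st i e Q :
  Q (set_var st i (eval st e)) -> total (Assign i e) st 1 Q.
Proof. by eexists _, 1; split; first constructor. Qed.

Lemma total_store st a e1 e2 Q :
  Q (set_arr st a (eval st e1) (eval st e2)) -> total (Store a e1 e2) st 1 Q.
Proof. by eexists _, 1; split; first constructor. Qed.

Lemma total_seq c1 c2 st T1 T2 Q :
  total c1 st T1 (fun st1 => total c2 st1 T2 Q) ->
  total (Seq c1 c2) st (T1 + T2) Q.
Proof.
case=> st1 [t1 [run1 le1 [st2 [t2 [run2 le2 q]]]]]; exists st2, (t1 + t2).
by split=> //; [apply: exec_seq run1 run2 | rewrite leq_add].
Qed.

Lemma total_if e1 e2 c1 c2 st T Q :
  (eval st e1 < eval st e2 -> total c1 st T Q) ->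
  (eval st e2 <= eval st e1 -> total c2 st T Q) ->
  total (IfLt e1 e2 c1 c2) st T.+1 Q.
Proof.
move=> h1 h2; have [lt|le] := ltnP (eval st e1) (eval st e2).
  have [st' [t [run t_le q]]] := h1 lt; exists st', t.+1; split=> //.
  exact: exec_if_true.
have [st' [t [run t_le q]]] := h2 le; exists st', t.+1; split=> //.
exact: exec_if_false.
Qed.

(** The number in the invariant is a strictly decreasing variant, so there are at most [k] rounds,
    each paying for the body and a test; the final test adds one. *)
Lemma total_while e1 e2 c T (I : memory -> nat -> Prop) st k :
  (forall st k, I st k -> eval st e1 < eval st e2 ->
     total c st T (fun st' => exists2 k', k' < k & I st' k')) ->
  I st k ->
  total (WhileLt e1 e2 c) st (k * T.+1).+1
    (fun st' => (exists k', I st' k') /\ eval st' e2 <= eval st' e1).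
Proof.
move=> body; have [m] := ubnP k; elim: m k st => // m IH k st km inv.
have [lt|le] := ltnP (eval st e1) (eval st e2); last first.
  exists st, 1; split=> //; first exact: exec_while_false.
  by split=> //; exists k.
have [st1 [t1 [run1 le1 [k1 k1k inv1]]]] := body _ _ inv lt.
have [st2 [t2 [run2 le2 q]]] := IH k1 st1 ltac:(lia) inv1.
exists st2, (t1 + t2).+1; split=> //; first exact: exec_while_true run1 run2.
rewrite ltnS; apply: leq_trans (leq_add le1 le2) _; nia.
Qed.

End TotalCorrectness.

(** * Kahn's algorithm and its invariant *)

Section Acyclic.
Variables (T : finType) (E : {set T * T}).

(** Take [v] in [A] with the fewest ancestors. A predecessor in [A] would have strictly fewer, as it
    cannot have [v] as an ancestor without closing a cycle. *)
Lemma acyclic_minimal (A : {set T}) : acyclic E -> A != set0 ->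
  exists2 v, v \in A & forall u, (u, v) \in E -> u \notin A.
Proof.
move=> acE /set0Pn[v0 v0A].
pose anc v := [set u | connect (rel_of E) u v].
case: (arg_minnP (fun v => #|anc v|) v0A) => v vA v_min.
exists v => // u uv; apply/negP => /v_min; apply/negP; rewrite -ltnNge.
apply/proper_card/properP; split.
  apply/subsetP => w; rewrite !inE => /connect_trans; apply.
  exact: connect1.
exists v; rewrite !inE //; apply/negP => /connectP[p vp eq_u].
by have := acE (v :: p) isT; rewrite /= rcons_path vp -eq_u; case/negP.
Qed.

End Acyclic.

Section Kahn.
Variables (n : nat) (E : {set 'I_n * 'I_n}) (o d : nat -> nat).
Hypothesis o0 : o 0 = 0.
Hypothesis o_mono : forall u : 'I_n, o u <= o u.+1.
Hypothesis d_adj : forall u : 'I_n,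
  perm_eq [seq d j | j <- index_iota (o u) (o u.+1)]
          [seq val v | v <- enum [set v | (u, v) \in E]].
Implicit Types (q : seq 'I_n) (U : {set 'I_n * 'I_n}) (u v : 'I_n).

(** The adjacency segments tile the cells from 0 to [o n]. A constant [F] then counts the edges, an
    indicator the indegree of a vertex. *)
Lemma sum_adj (F : nat -> nat) :
  \sum_(0 <= j < o n) F (d j) = \sum_u \sum_(v | (u, v) \in E) F v.
Proof.
have seg u : \sum_(o u <= j < o u.+1) F (d j) = \sum_(v | (u, v) \in E) F v.
  rewrite -(big_map d predT F) (perm_big _ (d_adj u)) big_map big_enum /=.
  by apply: eq_bigl => v; rewrite inE.
under [RHS]eq_bigr do rewrite -seg.
rewrite -(big_mkord predT (fun k => \sum_(o k <= j < o k.+1) F (d j))).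
have: n <= n by []; elim: {1 3 4}n => [|k IH] kn; first by rewrite o0 !big_geq.
have mono : forall i, i <= k -> o 0 <= o i.
  by move=> i _; rewrite o0.
rewrite big_nat_recr //= -IH ?(ltnW kn) //.
by rewrite -big_cat_nat //; have := o_mono (Ordinal kn).
Qed.

Lemma size_adj : o n = #|E|.
Proof.
have := sum_adj (fun=> 1); rewrite sum_nat_const_nat muln1 subn0 => ->.
by rewrite pair_big_dep /= -sum1_card; apply: eq_bigl => -[u v].
Qed.

Definition indeg U v := #|[set u | (u, v) \in U]|.

Lemma count_adj v : \sum_(0 <= j < o n) (d j == v) = indeg E v.
Proof.
rewrite (sum_adj (fun x => x == v : nat)) /indeg -sum1_card [RHS]big_mkcond /=.
apply: eq_bigr => u _; rewrite inE big_mkcond (bigD1 v) //= eqxx.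
rewrite big1 ?addn0 // => w /negPf; rewrite -val_eqE => ->; exact: if_same.
Qed.

Lemma indeg_gt0 U u v : (u, v) \in U -> 0 < indeg U v.
Proof. by move=> uv; rewrite card_gt0; apply/set0Pn; exists u; rewrite inE. Qed.

Lemma indeg_rem U u v w : (u, v) \in U ->
  indeg U w = (w == v) + indeg (U :\ (u, v)) w.
Proof.
move=> uv; rewrite /indeg; have [->|wv] := eqVneq w v.
  rewrite (cardsD1 u) inE uv; congr (_ + #|pred_of_set _|).
  by apply/setP => x; rewrite !inE xpair_eqE eqxx andbT.
by apply: eq_card => x; rewrite !inE xpair_eqE (negPf wv) andbF.
Qed.

Lemma mem_adj u v : ((u, v) \in E) = (val v \in [seq d j | j <- index_iota (o u) (o u.+1)]).
Proof. by rewrite (perm_mem (d_adj u)) (mem_map val_inj) mem_enum inE. Qed.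

(* [U] holds the edges not yet scanned: those leaving the vertices that are not
   in the queue [q], or behind its position [h], and those leaving the vertex at
   position [h] that are listed from position [j] on. *)
Record kahn q (h j : nat) U : Prop := Kahn {
  kahn_sub : U \subset E;
  kahn_uniq : uniq q;
  kahn_head : h <= size q;
  kahn_ready : forall v, (v \in q) = (indeg U v == 0);
  kahn_sorted : forall u v, (u, v) \in E -> v \in q -> index u q < index v q;
  kahn_cursor : forall u, u \in q -> index u q = h -> o u <= j <= o u.+1;
  kahn_unscanned : forall u v, (u, v) \in E ->
    ((u, v) \in U) =
    [|| u \notin q, h < index u q |
        (index u q == h) && (val v \in [seq d l | l <- index_iota j (o u.+1)])]
}.

(** No edge enters a source, so [kahn_sorted] is vacuous. The condition on [j] is conditional
    because the queue may be empty. *)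
Lemma kahn_start q j :
  uniq q -> (forall v, (v \in q) = (indeg E v == 0)) ->
  (forall u, u \in q -> index u q = 0 -> j = o u) -> kahn q 0 j E.
Proof.
move=> q_uniq q_ready j_eq; split=> // [u v uv|u uq u0|u v uv].
- by rewrite q_ready => /eqP v0; have := indeg_gt0 uv; rewrite v0.
- by rewrite (j_eq u uq u0) leqnn o_mono.
- rewrite uv; case: (boolP (u \in q)) => //= uq.
  have [u0|//] := posnP (index u q).
  by rewrite /= (j_eq u uq u0) -mem_adj.
Qed.

Lemma kahn_next q h j j' U :
  kahn q h j U -> h < size q ->
  (forall u, u \in q -> index u q = h -> o u.+1 <= j) ->
  (forall u, u \in q -> index u q = h.+1 -> j' = o u) ->
  kahn q h.+1 j' U.
Proof.
case=> sub q_uniq _ ready srt cursor unsc hq j_end j_eq.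
split=> // [u uq u0|u v uv]; first by rewrite (j_eq u uq u0) leqnn o_mono.
rewrite unsc //; case: (boolP (u \in q)) => //= uq.
(* The old head has no listed edge left, and for the new head the cursor starts at the beginning of
   its segment; all other vertices keep their status. *)
have [lt|gt|eq_h] := ltngtP h (index u q).
- have [//|//|eq_h1] := ltngtP h.+1 (index u q); first by lia.
  by rewrite /= (j_eq u uq) // -mem_adj.
- have [-> ->] : (h.+1 < index u q) = false /\ (index u q == h.+1) = false by lia.
  by [].
- have [-> ->] : (h.+1 < index u q) = false /\ (index u q == h.+1) = false by lia.
  by rewrite /= /index_iota (eqP (j_end u uq _)).
Qed.

Lemma kahn_scan q h j U u :
  kahn q h j U -> u \in q -> index u q = h -> j < o u.+1 ->
  exists v, [/\ val v = d j, (u, v) \in U &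
    kahn (if indeg (U :\ (u, v)) v == 0 then rcons q v else q) h j.+1
         (U :\ (u, v))].
Proof.
case=> sub q_uniq hq ready srt cursor unsc uq u_h j_lt.
have /andP[le_j _] := cursor u uq u_h.
have [v /andP[uv vE]] : exists v, ((u, v) \in E) && (val v == d j).
  have : d j \in [seq val v | v <- enum [set v | (u, v) \in E]].
    by rewrite -(perm_mem (d_adj u)) map_f // mem_index_iota le_j.
  by case/mapP => v; rewrite mem_enum inE => uv ->; exists v; rewrite uv eqxx.
exists v.
have iota_j : index_iota j (o u.+1) = j :: index_iota j.+1 (o u.+1).
  by rewrite /index_iota -subnSK.
(* Each neighbour is listed once, so advancing the cursor drops exactly the edge (u, v). *)
have v_rest : val v \notin [seq d l | l <- index_iota j.+1 (o u.+1)].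
  have : uniq [seq d l | l <- index_iota (o u) (o u.+1)].
    by rewrite (perm_uniq (d_adj u)) (map_inj_uniq val_inj) enum_uniq.
  rewrite /index_iota (_ : o u.+1 - o u = (j - o u) + (o u.+1 - j)).
  2: by rewrite addnC addnBA // subnK // ltnW.
  rewrite iotaD subnKC // map_cat cat_uniq -/(index_iota j _) iota_j /=.
  by rewrite (eqP vE); case/and3P => _ _ /andP[].
have uvU : (u, v) \in U.
  by rewrite unsc // u_h eqxx iota_j /= inE vE !orbT.
have v_notin : v \notin q by rewrite ready -lt0n (indeg_gt0 uvU).
have u_ne : u != v by apply: contraNneq v_notin => <-.
set U' := U :\ (u, v); pose q' := if indeg U' v == 0 then rcons q v else q.
rewrite -/q'.
have q'_sub w : w \in q -> (w \in q') /\ index w q' = index w q.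
  move=> wq; rewrite /q'; case: ifP => // _.
  by rewrite mem_rcons inE wq orbT -cats1 index_cat wq.
have q'_v : v \in q' -> index v q' = size q /\ indeg U' v = 0.
  rewrite /q'; case: eqP => [v0 _|_ vq]; last by rewrite vq in v_notin.
  by rewrite -cats1 index_cat (negPf v_notin) /= eqxx addn0.
have q'_mem w : w \in q' -> w = v \/ w \in q.
  rewrite /q'; case: ifP => _ => [|->]; last by right.
  by rewrite mem_rcons inE => /orP[/eqP|]; auto.
have uh : h < size q by rewrite -u_h index_mem.
have unsc' x y : (x, y) \in E -> ((x, y) \in U') =
    [|| x \notin q', h < index x q' |
        (index x q' == h) && (val y \in [seq d l | l <- index_iota j.+1 (o x.+1)])].
  move=> xy; rewrite !inE xpair_eqE unsc //.
  have [->|xu] := eqVneq x u.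
    have [-> ->] := q'_sub u uq; rewrite uq u_h ltnn eqxx /= iota_j /= inE.
    rewrite -(eqP vE) val_eqE; have [->|//] := eqVneq y v.
    exact/esym/negbTE.
  have xh : x \in q -> index x q == h = false.
    move=> xq; apply/negP => /eqP; rewrite -u_h => e.
    by rewrite -(nth_index u xq) e nth_index ?eqxx in xu.
  have [xq|xq] /= := boolP (x \in q); first by have [-> ->] := q'_sub x xq; rewrite xh.
  case: (boolP (x \in q')) => // xq'; case: (q'_mem x xq') => [xv|xq2]; last first.
    by rewrite xq2 in xq.
  by move: xq'; rewrite xv => /q'_v[-> _]; rewrite uh.
split=> //; first exact/eqP.
split=> //.
- by apply: subset_trans sub; exact: subD1set.
- by rewrite /q'; case: ifP; rewrite ?rcons_uniq ?v_notin.
- by rewrite /q'; case: ifP; rewrite ?size_rcons // ltnW.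
- move=> w; rewrite /q'; have [->|wv] := eqVneq w v.
    by case: ifP => _; rewrite ?mem_rcons ?mem_head ?(negPf v_notin).
  have -> : indeg U' w = indeg U w by rewrite (indeg_rem w uvU) (negPf wv).
  by rewrite -ready; case: ifP; rewrite // mem_rcons inE (negPf wv).
- move=> x y xy yq'; case: (q'_mem y yq') => [yv|yq].
    rewrite yv in xy yq' *; have [-> v0] := q'_v yq'.
    (* If [v] has just been appended, none of its incoming edges is unscanned, so each of its
       predecessors is already in [q]. *)
    have xq : x \in q.
      have : (x, v) \notin U' by apply/negP => /indeg_gt0; rewrite v0.
      have [->//|xu] := eqVneq x u.
      by rewrite !inE xpair_eqE (negPf xu) /= unsc // => /norP[/negPn].
    by rewrite (q'_sub x xq).2 index_mem.
  have lt := srt _ _ xy yq.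
  have xq : x \in q by rewrite -index_mem (ltn_trans lt) // index_mem.
  by rewrite (q'_sub x xq).2 (q'_sub y yq).2.
- move=> x xq'; case: (q'_mem x xq') => [xv|xq].
    by move: xq'; rewrite xv => /q'_v[-> _] e; rewrite e ltnn in uh.
  rewrite (q'_sub x xq).2 => e.
  have -> : x = u by rewrite -(nth_index u xq) e -u_h nth_index.
  by rewrite ltnW // j_lt.
Qed.

Lemma kahn_stop q h j U : acyclic E -> kahn q h j U -> size q <= h ->
  topological_ordering E q.
Proof.
move=> acE [sub q_uniq hq ready srt cursor unsc] qh.
have eq_h : h = size q by apply/eqP; rewrite eqn_leq hq.
(* Otherwise take a minimal vertex outside the queue. Its predecessors are all queued before [h], so
   its incoming edges are all scanned and it would be queued by [kahn_ready]. *)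
have q_all v : v \in q.
  apply/negPn/negP => vq.
  have A_ne : [set v | v \notin q] != set0 by apply/set0Pn; exists v; rewrite inE.
  have [w] := acyclic_minimal acE A_ne; rewrite inE => wq w_min.
  move: (wq); rewrite ready => /negP; apply; rewrite cards_eq0.
  apply/eqP/setP => u; rewrite !inE; apply/negP => uw.
  have uwE := subsetP sub _ uw.
  have := w_min u uwE; rewrite inE negbK => uq.
  move: uw; rewrite unsc // uq eq_h ltnNge ltnW ?index_mem //=.
  by rewrite ltn_eqF // index_mem.
apply/andP; split.
  apply: uniq_perm => //; first exact: enum_uniq.
  by move=> v; rewrite q_all mem_enum.
apply/forallP => u; apply/forallP => v; apply/implyP => uv.
exact: srt.
Qed.

End Kahn.

(** * The machine program and its running time *)

Section Program.

Definition i_var := 1.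
Definition head_var := 2.
Definition tail_var := 3.
Definition j_var := 4.
Definition deg_arr := 3.

Definition next (i : nat) : cmd := Assign i (Succ (Var i)).

Definition target : expr := Get adj_arr (Var j_var).

Definition enqueue (v : expr) : cmd :=
  IfLt (Get deg_arr v) (Const 1)
    (Seq (Store out_arr (Var tail_var) v) (next tail_var)) Skip.

(** The counters start uninitialised and must be zeroed before counting. *)
Definition clear_degrees : cmd :=
  Seq (Assign i_var (Const 0))
    (WhileLt (Var i_var) (Var n_var)
      (Seq (Store deg_arr (Var i_var) (Const 0)) (next i_var))).

Definition count_degrees : cmd :=
  Seq (Assign j_var (Const 0))
    (WhileLt (Var j_var) (Get off_arr (Var n_var))
      (Seq (Store deg_arr target (Succ (Get deg_arr target))) (next j_var))).

Definition enqueue_sources : cmd :=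
  Seq (Seq (Assign tail_var (Const 0)) (Assign i_var (Const 0)))
    (WhileLt (Var i_var) (Var n_var) (Seq (enqueue (Var i_var)) (next i_var))).

Definition rewind : cmd :=
  Assign j_var (Get off_arr (Get out_arr (Var head_var))).

Definition scan_edge : cmd :=
  Seq (Store deg_arr target (Pred (Get deg_arr target)))
    (Seq (enqueue target) (next j_var)).

(* The vertices and the edges are traversed by one loop: each round scans one
   edge leaving the vertex at the head of the queue, or advances the head.
   When the queue runs empty, [rewind] reads a meaningless cell, but then the
   loop stops. *)
Definition process_queue : cmd :=
  Seq (Seq (Assign head_var (Const 0)) rewind)
    (WhileLt (Var head_var) (Var tail_var)
      (IfLt (Var j_var) (Get off_arr (Succ (Get out_arr (Var head_var))))
        scan_edge (Seq (next head_var) rewind))).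

Definition kahn_program : cmd :=
  Seq (Seq clear_degrees count_degrees) (Seq enqueue_sources process_queue).

Variables (n : nat) (E : {set 'I_n * 'I_n}) (o d : nat -> nat).
Hypothesis o0 : o 0 = 0.
Hypothesis o_mono : forall u : 'I_n, o u <= o u.+1.
Hypothesis d_adj : forall u : 'I_n,
  perm_eq [seq d j | j <- index_iota (o u) (o u.+1)]
          [seq val v | v <- enum [set v | (u, v) \in E]].

Definition input (st : memory) : Prop :=
  [/\ var st n_var = n, arr st off_arr = o & arr st adj_arr = d].

Definition degrees (st : memory) (f : 'I_n -> nat) : Prop :=
  forall v : 'I_n, arr st deg_arr v = f v.

Definition queue (st : memory) (q : seq 'I_n) : Prop :=
  var st tail_var = size q /\ mkseq (arr st out_arr) (size q) = map val q.

Lemma queue_nth st q u : queue st q -> u \in q ->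
  arr st out_arr (index u q) = u.
Proof.
case=> _ /(congr1 (fun s => nth 0 s (index u q))).
by move=> h uq; move: h; rewrite nth_mkseq ?index_mem // (nth_map u) ?index_mem // nth_index.
Qed.

Lemma total_enqueue st e q (v : 'I_n) f (Q : memory -> Prop) :
  eval st e = v -> input st -> degrees st f -> queue st q ->
  (forall st', input st' -> degrees st' f ->
     queue st' (if f v == 0 then rcons q v else q) ->
     (forall i, i != tail_var -> var st' i = var st i) -> Q st') ->
  total (enqueue e) st 3 Q.
Proof.
move=> ev [n_st o_st d_st] deg [tl out] post.
apply: total_if; rewrite /= ev deg => f_v.
  apply: (@total_seq _ _ _ 1 1); apply: total_store; apply: total_assign.
  apply: post => //=.
    have -> : f v == 0 by rewrite -leqn0.
    split; rewrite /= size_rcons ?tl //= /mkseq -addn1 iotaD map_cat /= map_rcons -cats1.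
    congr (_ ++ [:: _]); last by rewrite ev /= eqxx.
    rewrite -out; apply/eq_in_map => l; rewrite mem_iota add0n => /andP[_ l_lt].
    by rewrite ltn_eqF.
  by move=> i /negPf ->.
apply: (@total_le _ _ 1) => //; apply: total_skip; apply: post => //.
by rewrite eqn0Ngt f_v.
Qed.

Lemma total_clear_degrees st : input st ->
  total clear_degrees st (n * 3 + 2)
    (fun st' => input st' /\ degrees st' (fun=> 0)).
Proof.
move=> [n_st o_st d_st].
apply: (@total_le _ _ (1 + (n * 3).+1)); first by lia.
apply: total_seq; apply: total_assign.
pose I st k := [/\ input st, forall v, v < var st i_var -> arr st deg_arr v = 0,
  var st i_var <= n & k = n - var st i_var].
apply: total_imp (total_while (I := I) _ _).
- move=> st' [[k [inp deg i_le _]]] /=; case: (inp) => -> _ _ le.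
  by split=> // v; apply: deg; apply: leq_trans le.
- move=> {n_st o_st d_st}st k [[n_st o_st d_st] deg i_le ->] /= i_lt.
  apply: (@total_seq _ _ _ 1 1); apply: total_store; apply: total_assign.
  exists (n - (var st i_var).+1); first by move: i_lt; rewrite n_st; lia.
  split=> //=; last by rewrite -n_st.
  move=> v; rewrite ltnS leq_eqVlt; case: eqP => //= _; exact: deg.
- by split=> //=; rewrite subn0.
Qed.

Lemma total_count_degrees st : input st -> degrees st (fun=> 0) ->
  total count_degrees st (o n * 3 + 2)
    (fun st' => input st' /\ degrees st' (indeg E)).
Proof.
move=> [n_st o_st d_st] deg0.
apply: (@total_le _ _ (1 + (o n * 3).+1)); first by lia.
apply: total_seq; apply: total_assign.
pose I st k := [/\ input st,
  degrees st (fun v => \sum_(0 <= l < var st j_var) (d l == v)),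
  var st j_var <= o n & k = o n - var st j_var].
apply: total_imp (total_while (I := I) _ _).
- move=> st' [[k [inp deg j_le _]]] /=; case: (inp) => -> -> _ le.
  split=> // v; rewrite deg -(count_adj o0 o_mono d_adj).
  by congr (\sum_(0 <= l < _) _); apply/eqP; rewrite eqn_leq j_le.
- move=> {n_st o_st d_st deg0}st k [[n_st o_st d_st] deg j_le ->] /=.
  rewrite n_st o_st => j_lt.
  apply: (@total_seq _ _ _ 1 1); apply: total_store; apply: total_assign.
  exists (o n - (var st j_var).+1); first by lia.
  split=> //= v /=; rewrite big_nat_recr //= -deg d_st eq_sym.
  by case: eqP => [->|_]; rewrite ?addn1 ?addn0.
- split=> //=; last by rewrite subn0.
  by move=> v; rewrite /= big_geq //; exact: deg0.
Qed.

Lemma total_enqueue_sources st : input st -> degrees st (indeg E) ->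
  total enqueue_sources st (n * 5 + 3)
    (fun st' => [/\ input st', degrees st' (indeg E) &
       exists q, [/\ queue st' q, uniq q &
         forall v, (v \in q) = (indeg E v == 0)]]).
Proof.
move=> [n_st o_st d_st] deg.
apply: (@total_le _ _ (1 + 1 + (n * 5).+1)); first by lia.
apply: total_seq; apply: total_seq; apply: total_assign; apply: total_assign.
pose I st k := [/\ input st, degrees st (indeg E),
  exists q, [/\ queue st q, uniq q &
    forall v : 'I_n, (v \in q) = (v < var st i_var) && (indeg E v == 0)],
  var st i_var <= n & k = n - var st i_var].
apply: total_imp (total_while (I := I) _ _).
- move=> st' [[k [inp deg' [q [qu q_uniq q_mem]] i_le _]]] /=.
  case: (inp) => -> _ _ le; split=> //; exists q; split=> // v.
  by rewrite q_mem (leq_trans (ltn_ord v)).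
- move=> {n_st o_st d_st deg}st k [inp deg [q [qu q_uniq q_mem]] i_le ->] /=.
  case: (inp) => -> _ _ i_lt.
  apply: (@total_seq _ _ _ 3 1).
  apply: (total_enqueue (v := Ordinal i_lt) _ inp deg qu) => //.
  move=> st' inp' deg' qu' var'; apply: total_assign.
  exists (n - (var st i_var).+1); first by lia.
  split=> //=; rewrite ?var' //.
  exists (if indeg E (Ordinal i_lt) == 0 then rcons q (Ordinal i_lt) else q).
  split=> //.
    by case: ifP; rewrite ?rcons_uniq ?q_uniq // q_mem ltnn.
  move=> v; rewrite ltnS leq_eqVlt -[val v == _]/(v == Ordinal i_lt).
  have [->|vi] := eqVneq v (Ordinal i_lt).
    by case: ifP => _; rewrite ?mem_rcons ?mem_head // q_mem ltnn.
  by case: ifP; rewrite ?mem_rcons ?inE ?(negPf vi) /= q_mem.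
- by split=> //=; [exists [::] | rewrite subn0].
Qed.

Lemma total_process_queue st q : acyclic E -> input st -> degrees st (indeg E) ->
  queue st q -> uniq q -> (forall v, (v \in q) = (indeg E v == 0)) ->
  total process_queue st ((n + #|E|) * 7 + 3)
    (fun st' => exists2 q', queue st' q' & topological_ordering E q').
Proof.
move=> acE [n_st o_st d_st] deg qu q_uniq q_mem.
apply: (@total_le _ _ (1 + 1 + ((n + #|E|) * 7).+1)); first by lia.
apply: total_seq; apply: total_seq; apply: total_assign; apply: total_assign.
(* Each round removes an edge from [U] or advances the head, so the variant drops by one. *)
pose I st k := exists q U, [/\ input st, degrees st (indeg U), queue st q,
  kahn E o d q (var st head_var) (var st j_var) U &
  k = (n - var st head_var) + #|U|].
apply: total_imp (total_while (I := I) _ _).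
- move=> st' [[k [q' [U [inp deg' qu' kq _]]]]] /=; case: (qu') => -> _ le.
  by exists q' => //; exact: kahn_stop kq le.
- move=> {n_st o_st d_st deg qu q_uniq q_mem q}st k [q [U [inp deg qu kq ->]]] /=.
  case: (qu) => -> out_q h_lt; case: (inp) => n_st o_st d_st.
  have u0 : 'I_n by case: (q) h_lt.
  pose u := nth u0 q (var st head_var).
  have uq : u \in q by rewrite mem_nth.
  have u_h : index u q = var st head_var by rewrite index_uniq // (kahn_uniq kq).
  have out_u : arr st out_arr (var st head_var) = u.
    by rewrite -u_h (queue_nth qu).
  (* The queue has distinct entries, so its length is at most n; hence advancing the head strictly
     decreases [n - var st head_var]. *)
  have h_n : var st head_var < n.
    apply: leq_trans h_lt _; rewrite -(card_uniqP (kahn_uniq kq)).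
    by rewrite -[X in _ <= X]card_ord max_card.
  apply: total_if; rewrite /= o_st out_u => j_cmp.
    have [v [vE uvU kq']] := kahn_scan d_adj kq uq u_h j_cmp.
    apply: (@total_seq _ _ _ 1 4); apply: total_store => /=.
    apply: (@total_seq _ _ _ 3 1).
    set st1 := set_arr _ _ _ _.
    have deg1 : degrees st1 (indeg (U :\ (u, v))).
      move=> w /=; rewrite d_st -vE val_eqE !deg !(indeg_rem _ uvU) eqxx.
      by case: eqVneq => [->|].
    apply: (@total_enqueue st1 target q v _ _ _ _ deg1) => //.
    + by rewrite /= d_st.
    + move=> st' inp' deg' qu' var'; apply: total_assign.
      exists ((n - var st head_var) + #|U :\ (u, v)|).
        by rewrite [X in _ < _ + X](cardsD1 (u, v)) uvU ltn_add2l.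
      exists (if indeg (U :\ (u, v)) v == 0 then rcons q v else q), (U :\ (u, v)).
      by split; rewrite //= !var'.
  apply: (@total_le _ _ 2) => //.
  apply: (@total_seq _ _ _ 1 1); apply: total_assign; apply: total_assign => /=.
  exists ((n - (var st head_var).+1) + #|U|); first by rewrite ltn_add2r ltn_sub2l.
  exists q, U; split=> //=.
  apply: kahn_next kq h_lt _ _ => // w wq w_h.
    by rewrite (_ : w = u) // -(nth_index u wq) w_h -u_h nth_index.
  by rewrite -w_h (queue_nth qu) ?o_st.
- exists q, E; split=> //=; last by rewrite subn0.
  apply: kahn_start => // w wq w0; rewrite o_st -w0.
  by rewrite (queue_nth qu).
Qed.

Lemma total_kahn_program st : acyclic E -> input st ->
  total kahn_program st (18 * (n + #|E| + 1))
    (fun st' => exists2 q, queue st' q & topological_ordering E q).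
Proof.
move=> acE inp.
(* With [o n] equal to m, the four phases take at most 15n + 10m + 10 steps. *)
apply: (@total_le _ _ ((n * 3 + 2 + (o n * 3 + 2)) +
  (n * 5 + 3 + ((n + #|E|) * 7 + 3)))).
  by rewrite (size_adj o0 o_mono d_adj); lia.
apply: total_seq; apply: total_seq.
apply: total_imp (total_clear_degrees inp) => st1 [inp1 deg1].
apply: total_imp (total_count_degrees inp1 deg1) => st2 [inp2 deg2].
apply: total_seq.
apply: total_imp (total_enqueue_sources inp2 deg2) => st3.
case=> inp3 deg3 [q [qu q_uniq q_mem]].
exact: total_process_queue qu q_uniq q_mem.
Qed.

End Program.

Lemma kahn_program_correct n (E : {set 'I_n * 'I_n}) st :
  acyclic E -> encodes E st ->
  total kahn_program st (18 * (n + #|E| + 1))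
    (fun st' => topological_ordering E (output n st')).
Proof.
move=> acE [n_st o0 o_mono d_adj].
apply: total_imp (total_kahn_program o0 o_mono d_adj acE _) => // st'.
case=> q [_ out] q_top; rewrite /output.
(* The queue holds all n vertices, so the cells read by [output] are exactly its entries. *)
have size_q : size q = n.
  by case/andP: q_top => /perm_size ->; rewrite -cardE card_ord.
by move: out; rewrite size_q => ->; rewrite (map_pK valK).
Qed.

Local Open Scope ring_scope.

Theorem theorem4 (R : realType) :
  (exists pre : cmd,
     computes_topological_ordering pre /\ runs_in_linear_time pre) /\
  (forall H : heap,
     heap_correct H -> has_unified_bound R H ->
     exists c : R,
     forall pre : cmd, computes_topological_ordering pre ->
     forall (n : nat) (E L : {set 'I_n * 'I_n}) (st : memory),
       acyclic E -> compatible E L -> encodes E st ->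
       exists (out : seq 'I_n) (tpre tsort : nat),
         [/\ uni_top_sort pre H L st out tpre tsort,
             sorted_along L out
           & tsort%:R <= c * (log2 (num_orders E)%:R + n%:R)]).
Proof.
split.
  exists kahn_program; split.
    move=> n E st acE enc.
    have [st' [t [run_t _ top]]] := kahn_program_correct acE enc.
    by exists st', t.
  exists 18%N => n E st st' t acE enc run_t.
  have [st1 [t1 [run_t1 t1_le _]]] := kahn_program_correct acE enc.
  by have [_ ->] := exec_det run_t run_t1.
move=> H H_correct H_bound.
have [c sort_ok] := sorting_phase_correct H_correct H_bound.
exists c => pre pre_ok n E L st acE compat enc.
have [st' [tpre [run_pre top]]] := pre_ok n E st acE enc.
have := sort_ok _ E L _ top compat; rewrite card_ord.
case run_sort: (run _ _) => [out tsort] [/= out_enum out_sorted t_le].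
exists out, tpre, tsort; split=> //; last exact/andP.
by exists st'.
Qed.
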